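(* Let $n=p+q$, let $h^1,\dots,h^n:\mathbb{R}^{p,q}\to\mathcal{C}\ell_{\circledS}(p,q)$ be a Clifford field vector and $C_1,\dots,C_n:\mathbb{R}^{p,q}\to\mathcal{C}\ell_{\circledS}(p,q)$ (all with continuous partial derivatives up to second order) satisfying $\partial_\mu h_\rho-[C_\mu,h_\rho]=0$ for all $\mu,\rho$. Let $\sigma,\varepsilon\in\mathbb{C}$ with $\varepsilon=4(n-1)\sigma^3$. Define $B_\mu=\sigma h_\mu+C_\mu$ and $G_{\mu\nu}=\partial_\mu B_\nu-\partial_\nu B_\mu-[B_\mu,B_\nu]$. Then $B_\mu\in\mathcal{C}\ell_{\circledS}(p,q)$ and the Yang–Mills equations $$\partial_\mu B_\nu-\partial_\nu B_\mu-[B_\mu,B_\nu]=G_{\mu\nu},\qquad \partial_\mu G^{\mu\nu}-[B_\mu,G^{\mu\nu}]=\varepsilon h^\nu\quad(\nu=1,\dots,n)$$ hold, where $G^{\mu\nu}=\eta^{\mu\alpha}\eta^{\nu\beta}G_{\alpha\beta}$ and summation over $\mu$ is implied.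
   Context: $\mathbb{R}^{p,q}$ is $\mathbb{R}^n$ with Cartesian coordinates $x^\mu$, $\partial_\mu=\partial/\partial x^\mu$, metric $\eta=(\eta_{\mu\nu})=(\eta^{\mu\nu})=\mathrm{diag}(1,\dots,1,-1,\dots,-1)$ ($p$ ones, $q$ minus ones); indices are lowered/raised with $\eta$ (e.g. $h_\mu=\eta_{\mu\nu}h^\nu$) and Einstein summation is used. $\mathcal{C}\ell(p,q)$ is the complex Clifford algebra with identity $e$ and generators $e^1,\dots,e^n$, $e^ae^b+e^be^a=2\eta^{ab}e$, with basis $e$, $e^{a_1\dots a_k}=e^{a_1}\cdots e^{a_k}$ ($a_1<\dots<a_k$); functions into it are differentiated coefficientwise. $[U,V]=UV-VU$. $\mathrm{Tr}(U)$ is the coefficient of $e$. The center is spanned by $e$ for even $n$ and by $e,e^{1\dots n}$ for odd $n$; $\mathcal{C}\ell_{\circledS}(p,q)$ is the set of elements with zero projection onto the center. A Clifford field vector is a collection $h^\mu:\mathbb{R}^{p,q}\to\mathcal{C}\ell(p,q)$, $\mu=1,\dots,n$, with $h^\mu h^\nu+h^\nu h^\mu=2\eta^{\mu\nu}e$ and $\mathrm{Tr}(h^1\cdots h^n)=0$ at every point. *)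

(* Defs.v *)
From HB Require Import structures.
From mathcomp Require Import all_boot all_order all_algebra.
From mathcomp Require Import all_classical all_reals all_analysis.
From mathcomp Require Export complex.
Set Implicit Arguments. Unset Strict Implicit. Unset Printing Implicit Defensive.
Import GRing.Theory Num.Theory numFieldNormedType.Exports.
Local Open Scope classical_set_scope.
Local Open Scope ring_scope.

Section Clifford.
Variable R : realType.
Variables p q : nat.
Local Notation n := (p + q)%N.
Local Notation C := R[i].

(* The complex Clifford algebra Cl(p,q): an element is its family of
   coefficients on the basis blades e^A = e^{a_1} ... e^{a_k} (a_1<...<a_k),
   a blade being indexed by the set A = {a_1,...,a_k} of 'I_n;
   the identity e is the blade indexed by set0. *)
Definition Cl := {ffun {set 'I_n} -> C}.

(* diagonal of the metric eta = diag(1,..,1,-1,..,-1) (p ones, q minus ones);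
   eta_{mu mu} = eta^{mu mu}. *)
Definition eta (i : 'I_n) : C := if (i < p)%N then 1 else -1.

Definition clbasis (A : {set 'I_n}) : Cl := [ffun S => (S == A)%:R].

Definition clone : Cl := clbasis finset.set0.

Definition symdiff (A B : {set 'I_n}) : {set 'I_n} := (A :\: B) :|: (B :\: A).

(* e^A e^B = blade_sign A B * e^(A sym.diff. B), obtained from
   e^a e^b + e^b e^a = 2 eta^{ab} e. *)
Definition blade_sign (A B : {set 'I_n}) : C :=
  (-1) ^+ #|[set ab : 'I_n * 'I_n | [&& ab.1 \in A, ab.2 \in B & (ab.2 < ab.1)%N]]|
  * \prod_(i in A :&: B) eta i.

Definition clmul (U V : Cl) : Cl :=
  \sum_(A : {set 'I_n}) \sum_(B : {set 'I_n})
     (U A * V B * blade_sign A B) *: clbasis (symdiff A B).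

Definition clprod (s : seq Cl) : Cl := foldr clmul clone s.

Definition clcomm (U V : Cl) : Cl := clmul U V - clmul V U.

Definition clTr (U : Cl) : C := U finset.set0.

(* the set Cl_(S)(p,q): zero projection onto the center, which is spanned by
   e for even n and by e, e^{1...n} for odd n *)
Definition in_clS (U : Cl) : Prop :=
  U finset.set0 = 0 /\ (odd n -> U (finset.setT : {set 'I_n}) = 0).

Definition unitv (mu : 'I_n) : 'rV[R]_n := delta_mx 0 mu.

Definition pdR (mu : 'I_n) (g : 'rV[R]_n -> R) : 'rV[R]_n -> R :=
  fun x => 'D_(unitv mu) g x.

Definition C2R (g : 'rV[R]_n -> R) : Prop :=
  continuous g /\
  (forall mu x, derivable g x (unitv mu)) /\
  (forall mu, continuous (pdR mu g)) /\
  (forall mu nu x, derivable (pdR mu g) x (unitv nu)) /\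
  (forall mu nu, continuous (pdR nu (pdR mu g))).

Definition clpartial (mu : 'I_n) (F : 'rV[R]_n -> Cl) : 'rV[R]_n -> Cl :=
  fun x => [ffun A => Complex (pdR mu (fun y => complex.Re (F y A)) x)
                              (pdR mu (fun y => complex.Im (F y A)) x)].

Definition C2Cl (F : 'rV[R]_n -> Cl) : Prop :=
  forall A, C2R (fun y => complex.Re (F y A)) /\ C2R (fun y => complex.Im (F y A)).

(* Clifford field vector h^1,...,h^n (upper indices) *)
Definition clifford_field_vector (h : 'I_n -> 'rV[R]_n -> Cl) : Prop :=
  forall x,
    (forall mu nu, clmul (h mu x) (h nu x) + clmul (h nu x) (h mu x)
                   = ((2 : C) * (if mu == nu then eta mu else 0)) *: clone)
    /\ clTr (clprod [seq h mu x | mu <- enum 'I_n]) = 0.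

Definition lower (h : 'I_n -> 'rV[R]_n -> Cl) (mu : 'I_n) : 'rV[R]_n -> Cl :=
  fun x => eta mu *: h mu x.

Definition YM_B (sigma : C) (h Cf : 'I_n -> 'rV[R]_n -> Cl) (mu : 'I_n)
  : 'rV[R]_n -> Cl :=
  fun x => sigma *: lower h mu x + Cf mu x.

Definition YM_G (B : 'I_n -> 'rV[R]_n -> Cl) (mu nu : 'I_n) : 'rV[R]_n -> Cl :=
  fun x => clpartial mu (B nu) x - clpartial nu (B mu) x - clcomm (B mu x) (B nu x).

Definition YM_Gup (B : 'I_n -> 'rV[R]_n -> Cl) (mu nu : 'I_n) : 'rV[R]_n -> Cl :=
  fun x => (eta mu * eta nu) *: YM_G B mu nu x.

End Clifford.

(* Main.v *)
(** By the trace condition the products [h^A] of the [h mu x] form a basis of the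
    Clifford algebra, since they are orthogonal for the trace form; so an element
    commuting with every [h mu x] is central, and vanishes if it has no central
    part.  Differentiating [d_mu h = [C_mu, h]] once more, equality of mixed
    partials and the Jacobi identity show that the curvature of [C] is such an
    element, hence zero.  Thus [G^{mu nu} = - sigma^2 [h^mu, h^nu]], which is again
    covariantly constant for [C], and only [- sigma [h_mu, G^{mu nu}]] survives in
    the divergence; each [mu <> nu] contributes [4 sigma^3 h^nu]. *)

Require Import Defs.
From HB Require Import structures.
From mathcomp Require Import all_boot all_order all_algebra.
From mathcomp Require Import all_classical all_reals all_analysis.
From mathcomp Require Import complex ring.
Import Order.TTheory GRing.Theory Num.Theory numFieldNormedType.Exports.
Local Open Scope classical_set_scope.
Local Open Scope ring_scope.

Set Implicit Arguments.
Unset Strict Implicit.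
Unset Printing Implicit Defensive.

Local Notation eta := Defs.eta.

(** * Signs arising when basis blades are multiplied *)

Section BladeSign.
Variables (R : realType) (p q : nat).
Local Notation n := (p + q)%N.
Local Notation C := R[i].
Implicit Types (A B D : {set 'I_n}).

(** An index lying in both sets occurs twice on the right, and its two factors cancel. *)
Lemma prod_symdiff (f : 'I_n -> C) A B : (forall i, f i * f i = 1) ->
  \prod_(i in symdiff A B) f i = (\prod_(i in A) f i) * \prod_(i in B) f i.
Proof.
move=> ff; rewrite !(big_mkcond (fun i => i \in _)) -big_split /=.
apply: eq_bigr => i _; rewrite /symdiff !inE.
by case: (i \in A); case: (i \in B); rewrite /= ?mulr1 ?mul1r ?ff.
Qed.

(** Contribution of one pair, [i] from the left blade and [j] from the right: the transposition sign
    if they are out of order, the metric if they coincide. *)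
Definition gen_sign (i j : 'I_n) : C :=
  if (j < i)%N then -1 else if i == j then eta R i else 1.

Lemma eta_sqr (i : 'I_n) : eta R i * eta R i = 1.
Proof. by rewrite /eta; case: ifP => _; rewrite ?mulrNN mulr1. Qed.

Lemma gen_sign_sqr i j : gen_sign i j * gen_sign i j = 1.
Proof.
rewrite /gen_sign; case: ifP => _; first by rewrite mulrNN mulr1.
by case: ifP => _; rewrite ?eta_sqr ?mulr1.
Qed.

Lemma gen_signC i j : gen_sign i j = - (-1) ^+ (i == j) * gen_sign j i.
Proof.
rewrite /gen_sign; case: (ltngtP i j) => [ij|ji|/val_inj ->].
- by rewrite -val_eqE /= (ltn_eqF ij) mulrNN mulr1.
- by rewrite -!val_eqE /= (gtn_eqF ji) (ltn_eqF ji) mulr1.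
- by rewrite eqxx expr1 opprK mul1r.
Qed.

(** With the inversion count and the metric merged into one product over pairs, multiplicativity
    under [symdiff] and the swap rule reduce to a single pair. *)
Lemma blade_signE A B :
  blade_sign R A B = \prod_(i in A) \prod_(j in B) gen_sign i j.
Proof.
have -> : \prod_(i in A) \prod_(j in B) gen_sign i j =
  \prod_(i in A) \prod_(j in B)
    ((-1) ^+ (j < i)%N * if i == j then eta R i else 1).
  apply: eq_bigr => i _; apply: eq_bigr => j _; rewrite /gen_sign.
  case: ltngtP => [ji|ij|/val_inj ->]; last by rewrite eqxx mul1r.
    by rewrite -val_eqE /= (gtn_eqF ji) mulr1.
  by rewrite -val_eqE /= (ltn_eqF ij) mulr1.
under eq_bigr do rewrite big_split /=.
rewrite big_split /= /blade_sign; congr (_ * _).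
  rewrite pair_big /= -sum1_card -prodrXr /=.
  rewrite [LHS]big_mkcond [RHS]big_mkcond /=; apply: eq_bigr => -[i j] _ /=.
  rewrite [_ \in in_set _]asboolb /=.
  by case: (i \in A); case: (j \in B); case: (j < i)%N.
rewrite (eq_bigl (fun i => (i \in A) && (i \in B))); last first.
  by move=> i; rewrite inE.
rewrite big_mkcondr /=; apply: eq_bigr => i _.
rewrite big_mkcond /=; rewrite (bigD1 i) //= eqxx big1 ?mulr1 //.
by move=> j; rewrite eq_sym => /negPf ->; case: ifP.
Qed.

(** Multiplicativity in each argument is what makes [clmul] associative. *)
Lemma blade_sign_symdiffl A B D :
  blade_sign R (symdiff A B) D = blade_sign R A D * blade_sign R B D.
Proof.
rewrite !blade_signE; apply: prod_symdiff => i.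
by rewrite -big_split big1 //= => j _; rewrite gen_sign_sqr.
Qed.

Lemma blade_sign_symdiffr A B D :
  blade_sign R D (symdiff A B) = blade_sign R D A * blade_sign R D B.
Proof.
rewrite !blade_signE -big_split; apply: eq_bigr => i _; apply: prod_symdiff.
exact: gen_sign_sqr.
Qed.

Lemma blade_sign_sqr A B : blade_sign R A B * blade_sign R A B = 1.
Proof.
rewrite blade_signE -big_split big1 //= => i _.
by rewrite -big_split big1 //= => j _; rewrite gen_sign_sqr.
Qed.

Lemma blade_sign_neq0 A B : blade_sign R A B != 0.
Proof.
by apply/negP => /eqP s0; move: (blade_sign_sqr A B); rewrite s0 mul0r => /eqP;
  rewrite eq_sym oner_eq0.
Qed.

Lemma blade_sign0l A : blade_sign R finset.set0 A = 1.
Proof. by rewrite blade_signE big_set0. Qed.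

Lemma blade_sign0r A : blade_sign R A finset.set0 = 1.
Proof. by rewrite blade_signE big1 // => i _; rewrite big_set0. Qed.

Lemma blade_sign1 (i : 'I_n) :
  blade_sign R (finset.set1 i) (finset.set1 i) = eta R i.
Proof. by rewrite blade_signE !big_set1 /gen_sign ltnn eqxx. Qed.

(** Swapping costs one sign per pair of distinct indices, that is for all pairs but the [#|A :&: B|]
    diagonal ones. *)
Lemma blade_signC A B :
  blade_sign R A B = (-1) ^+ (#|A| * #|B| + #|A :&: B|) * blade_sign R B A.
Proof.
rewrite !blade_signE [X in _ * X]exchange_big /=.
have -> : (-1) ^+ (#|A| * #|B| + #|A :&: B|) =
  \prod_(i in A) \prod_(j in B) - (-1) ^+ (i == j) :> C.
  transitivity (\prod_(i in A) ((-1) ^+ #|B| * (-1) ^+ (i \in B)) : C).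
    rewrite big_split /= prodr_const -exprM mulnC prodrXr exprD; congr (_ * _).
    congr (_ ^+ _); rewrite -sum1_card.
    rewrite (eq_bigl (fun i => (i \in A) && (i \in B))); last first.
      by move=> i; rewrite inE.
    by rewrite big_mkcondr /=; apply: eq_bigr => i _; case: (i \in B).
  apply: eq_bigr => i _; under eq_bigr do rewrite -mulN1r.
  rewrite big_split /= prodr_const; congr (_ * _).
  rewrite prodrXr; congr (_ ^+ _).
  rewrite big_mkcond (bigD1 i) //= eqxx big1 ?addn0; first by case: (i \in B).
  by move=> j; rewrite eq_sym => /negPf ->; case: ifP.
rewrite -big_split; apply: eq_bigr => i _; rewrite -big_split.
by apply: eq_bigr => j _; exact: gen_signC.
Qed.

Lemma symdiffxx A : symdiff A A = finset.set0.
Proof. by apply/setP => i; rewrite !inE; case: (i \in A). Qed.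

Lemma symdiffC A B : symdiff A B = symdiff B A.
Proof. by apply/setP => i; rewrite !inE orbC. Qed.

Lemma symdiffA A B D : symdiff A (symdiff B D) = symdiff (symdiff A B) D.
Proof.
by apply/setP => i; rewrite !inE; case: (i \in A); case: (i \in B);
  case: (i \in D).
Qed.

Lemma symdiff0s A : symdiff finset.set0 A = A.
Proof. by apply/setP => i; rewrite !inE; case: (i \in A). Qed.

Lemma symdiffs0 A : symdiff A finset.set0 = A.
Proof. by rewrite symdiffC symdiff0s. Qed.

Lemma symdiff_eq0 A B : (symdiff A B == finset.set0) = (A == B).
Proof.
apply/eqP/eqP => [AB0|->]; last exact: symdiffxx.
by rewrite -[B]symdiff0s -AB0 -symdiffA symdiffxx symdiffs0.
Qed.

End BladeSign.

(** * The Clifford product as an algebra structure, and its trace *)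

Section CliffordRing.
Variables (R : realType) (p q : nat).
Local Notation n := (p + q)%N.
Local Notation C := R[i].
Local Notation Cl := (Cl R p q).
Implicit Types (A B D S : {set 'I_n}) (U V W : Cl).

HB.instance Definition _ := GRing.Lmodule.copy Cl {ffun {set 'I_n} -> C}.

Lemma clDE U V S : (U + V) S = U S + V S. Proof. by rewrite ffunE. Qed.

Lemma clNE U S : (- U) S = - U S. Proof. by rewrite ffunE. Qed.

Lemma clZE (a : C) U S : (a *: U) S = a * U S. Proof. by rewrite ffunE. Qed.

Lemma cl_sumE I (r : seq I) (P : pred I) (F : I -> Cl) S :
  (\sum_(i <- r | P i) F i) S = \sum_(i <- r | P i) F i S.
Proof.
by elim/big_rec2: _ => [|i y U _ <-]; rewrite ffunE.
Qed.

Lemma clbasisE A S : clbasis R A S = (S == A)%:R. Proof. by rewrite ffunE. Qed.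

Lemma clbasis_sum U : U = \sum_A U A *: clbasis R A.
Proof.
apply/ffunP => S; rewrite cl_sumE (bigD1 S) //= big1 => [|A AS].
  by rewrite clZE clbasisE eqxx mulr1 addr0.
by rewrite clZE clbasisE eq_sym (negPf AS) mulr0.
Qed.

Lemma clmulDl : left_distributive (@clmul R p q) +%R.
Proof.
move=> U V W; rewrite /clmul -big_split; apply: eq_bigr => A _.
rewrite -big_split; apply: eq_bigr => B _ /=.
by rewrite clDE -scalerDl !mulrDl.
Qed.

Lemma clmulDr : right_distributive (@clmul R p q) +%R.
Proof.
move=> W U V; rewrite /clmul -big_split; apply: eq_bigr => A _.
rewrite -big_split; apply: eq_bigr => B _ /=.
by rewrite clDE -scalerDl mulrDr !mulrDl.
Qed.

Lemma clmulZl (a : C) U V : a *: clmul U V = clmul (a *: U) V.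
Proof.
rewrite /clmul scaler_sumr; apply: eq_bigr => A _.
rewrite scaler_sumr; apply: eq_bigr => B _ /=.
by rewrite clZE scalerA !mulrA.
Qed.

Lemma clmulZr (a : C) U V : a *: clmul U V = clmul U (a *: V).
Proof.
rewrite /clmul scaler_sumr; apply: eq_bigr => A _.
rewrite scaler_sumr; apply: eq_bigr => B _ /=.
by rewrite clZE scalerA; congr (_ *: _); rewrite (mulrCA (U A)) !mulrA.
Qed.

Lemma clmul0l U : clmul 0 U = 0.
Proof. by rewrite -[X in clmul X](scale0r U) -clmulZl scale0r. Qed.

Lemma clmul0r U : clmul U 0 = 0.
Proof. by rewrite -[X in clmul _ X](scale0r U) -clmulZr scale0r. Qed.

Lemma clmul_suml I (r : seq I) (F : I -> Cl) V :
  clmul (\sum_(i <- r) F i) V = \sum_(i <- r) clmul (F i) V.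
Proof.
by apply: (big_morph (fun U => clmul U V)) => [U W|]; rewrite ?clmulDl ?clmul0l.
Qed.

Lemma clmul_sumr I (r : seq I) (F : I -> Cl) V :
  clmul V (\sum_(i <- r) F i) = \sum_(i <- r) clmul V (F i).
Proof.
by apply: (big_morph (clmul V)) => [U W|]; rewrite ?clmulDr ?clmul0r.
Qed.

Lemma clbasisM A B :
  clmul (clbasis R A) (clbasis R B) = blade_sign R A B *: clbasis R (symdiff A B).
Proof.
rewrite /clmul (bigD1 A) //= (bigD1 B) //= !clbasisE !eqxx !mul1r.
rewrite big1 => [|D DB]; last by rewrite clbasisE (negPf DB) mulr0 mul0r scale0r.
rewrite big1 => [|D DA]; first by rewrite !addr0.
by apply: big1 => E _; rewrite clbasisE (negPf DA) !mul0r scale0r.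
Qed.

Lemma clbasisZM (a b : C) A B :
  clmul (a *: clbasis R A) (b *: clbasis R B) =
  (a * b * blade_sign R A B) *: clbasis R (symdiff A B).
Proof. by rewrite -clmulZl -clmulZr clbasisM !scalerA mulrA. Qed.

Lemma cl_ind (P : Cl -> Prop) : P 0 -> (forall U V, P U -> P V -> P (U + V)) ->
  (forall a A, P (a *: clbasis R A)) -> forall U, P U.
Proof. by move=> P0 PD PZ U; rewrite (clbasis_sum U); apply: big_ind. Qed.

(** Trilinearity reduces the claim to three blades, where both bracketings carry the product of the
    three pairwise signs. *)
Lemma clmulA : associative (@clmul R p q).
Proof.
move=> U V W; elim/cl_ind: U => [|U U' IU IU'|a A].
- by rewrite !clmul0l.
- by rewrite !clmulDl IU IU'.
elim/cl_ind: V => [|V V' IV IV'|b B].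
- by rewrite !(clmul0l, clmul0r).
- by rewrite !(clmulDl, clmulDr) IV IV'.
elim/cl_ind: W => [|W W' IW IW'|c D].
- by rewrite !clmul0r.
- by rewrite !clmulDr IW IW'.
rewrite !clbasisZM symdiffA blade_sign_symdiffl blade_sign_symdiffr.
by congr (_ *: _); ring.
Qed.

Lemma clmul1l : left_id (clone R p q) (@clmul R p q).
Proof.
move=> U; rewrite [in LHS](clbasis_sum U) clmul_sumr [RHS]clbasis_sum.
apply: eq_bigr => A _.
by rewrite -clmulZr /clone clbasisM blade_sign0l symdiff0s scale1r.
Qed.

Lemma clmul1r : right_id (clone R p q) (@clmul R p q).
Proof.
move=> U; rewrite [in LHS](clbasis_sum U) clmul_suml [RHS]clbasis_sum.
apply: eq_bigr => A _.
by rewrite -clmulZl /clone clbasisM blade_sign0r symdiffs0 scale1r.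
Qed.

Lemma clone_neq0 : clone R p q != 0.
Proof.
apply/eqP => /(congr1 (fun U : Cl => U finset.set0)).
by rewrite /clone clbasisE eqxx ffunE; apply/eqP/oner_neq0.
Qed.

HB.instance Definition _ := GRing.Zmodule_isNzRing.Build Cl
  clmulA clmul1l clmul1r clmulDl clmulDr clone_neq0.

HB.instance Definition _ := GRing.Lmodule_isLalgebra.Build _ Cl clmulZl.

HB.instance Definition _ := GRing.Lalgebra_isAlgebra.Build _ Cl clmulZr.

Lemma clmulE U V : clmul U V = U * V. Proof. by []. Qed.

Lemma cloneE : clone R p q = 1. Proof. by []. Qed.

Lemma clcommE U V : clcomm U V = U * V - V * U. Proof. by []. Qed.

Lemma clprodE (s : seq Cl) : clprod s = \prod_(U <- s) U.
Proof. by elim: s => [|U s IH]; rewrite ?big_nil // big_cons /= -IH. Qed.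

(** Once [A] is fixed, [symdiff A S] is the only blade whose product with [A] lands on [S]. *)
Lemma clmul_coef U V S :
  (U * V) S = \sum_A U A * V (symdiff A S) * blade_sign R A (symdiff A S).
Proof.
rewrite -clmulE /clmul cl_sumE; apply: eq_bigr => A _.
have sK B : symdiff A (symdiff A B) = B by rewrite symdiffA symdiffxx symdiff0s.
rewrite cl_sumE (bigD1 (symdiff A S)) //= big1 ?addr0.
  by rewrite clZE clbasisE sK eqxx mulr1.
move=> B BAS; rewrite clZE clbasisE; case: eqP => [SE|]; last by rewrite mulr0.
by rewrite SE sK eqxx in BAS.
Qed.

(** The involution sending [A] to [symdiff A S] exchanges the two factors, and the parity hypothesis
    says that this costs no sign. *)
Lemma clmul_coefC U V S :
  (forall A, ~~ odd (#|A| * #|symdiff A S| + #|A :&: symdiff A S|)) ->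
  (U * V) S = (V * U) S.
Proof.
move=> ev; rewrite !clmul_coef (reindex_inj (h := fun A => symdiff A S)) /=.
  apply: eq_bigr => A _; rewrite -symdiffA symdiffxx symdiffs0.
  rewrite [blade_sign R A _]blade_signC -signr_odd (negPf (ev A)) mul1r.
  by rewrite (mulrC (U _)).
by move=> A B /(congr1 (fun X => symdiff X S)); rewrite -!symdiffA symdiffxx !symdiffs0.
Qed.

(** The partner of [A] is [A] itself, and [#|A| * #|A| + #|A|] is even. *)
Lemma clTrM U V : clTr (U * V) = clTr (V * U).
Proof.
apply: clmul_coefC => A; rewrite symdiffs0 finset.setIid oddD oddM.
by case: (odd _).
Qed.

(** The partner of [A] is its complement; as [n] is odd, one of the two cardinals is even. *)
Lemma clmul_topC U V : odd n ->
  (U * V) (finset.setT : {set 'I_n}) = (V * U) (finset.setT : {set 'I_n}).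
Proof.
move=> odd_n; apply: clmul_coefC => A.
have -> : symdiff A finset.setT = ~: A.
  by apply/setP => i; rewrite !inE; case: (i \in A).
have := cardsC A; rewrite card_ord finset.setICr cards0 addn0 oddM => E.
by move: odd_n (congr1 odd E) => ->; rewrite oddD; case: (odd _); case: (odd _).
Qed.

Lemma clTrZ (a : C) U : clTr (a *: U) = a * clTr U. Proof. exact: clZE. Qed.

Lemma clTr_sum I (r : seq I) (F : I -> Cl) :
  clTr (\sum_(i <- r) F i) = \sum_(i <- r) clTr (F i).
Proof. exact: cl_sumE. Qed.

Lemma clTr1 : clTr (1 : Cl) = 1.
Proof. by rewrite -cloneE /clTr /clone clbasisE eqxx. Qed.

End CliffordRing.

(* Moving the last factor of the first product across the second one gives the
   signs one row at a time. *)
Lemma ordered_prodM (K : comPzRingType) (A : algType K) (m : nat)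
    (g : 'I_m -> A) (w : 'I_m -> 'I_m -> K) (a b : 'I_m -> bool) :
  (forall i j : 'I_m, (j < i)%N -> g i * g j = w i j *: (g j * g i)) ->
  (forall i, g i * g i = (w i i)%:A) ->
  (forall i j : 'I_m, (i < j)%N -> w i j = 1) ->
  (\prod_i g i ^+ a i) * (\prod_i g i ^+ b i) =
  (\prod_i \prod_j w i j ^+ (a i && b j)) *: \prod_i g i ^+ (a i (+) b i).
Proof.
elim: m g w a b => [|m IH] g w a b gC gg w1.
  by rewrite !big_ord0 scale1r mulr1.
pose u := widen_ord (leqnSn m).
have cross (s : 'I_m -> bool) : g ord_max * \prod_i g (u i) ^+ s i =
    (\prod_j w ord_max (u j) ^+ s j) *: (\prod_i g (u i) ^+ s i * g ord_max).
  have fC i : g ord_max * g (u i) = w ord_max (u i) *: (g (u i) * g ord_max).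
    by apply: gC; rewrite /= ltn_ord.
  elim/big_rec2: _ => [|i y z _ IHz]; first by rewrite scale1r mulr1 mul1r.
  case: (s i); last by rewrite /= !mul1r.
  by rewrite !expr1 mulrA fC -scalerAl -[_ * _ * z]mulrA IHz -scalerAr scalerA mulrA.
rewrite [X in X * _]big_ord_recr [X in _ * X]big_ord_recr.
rewrite [X in X *: _]big_ord_recr [X in _ *: X]big_ord_recr /= -/u.
(* In the earlier rows the last column is trivial by [w1]. *)
have -> : \prod_(i < m) \prod_(j < m.+1) w (u i) j ^+ (a (u i) && b j) =
          \prod_(i < m) \prod_(j < m) w (u i) (u j) ^+ (a (u i) && b (u j)).
  apply: eq_bigr => i _; rewrite big_ord_recr /= w1 ?expr1n ?mulr1 //.
  by have := ltn_ord i.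
rewrite big_ord_recr /= -/u.
have {}IH := IH (fun i => g (u i)) (fun i j => w (u i) (u j))
  (fun i => a (u i)) (fun i => b (u i)) _ _ _.
have {}IH := IH (fun i j ji => gC (u i) (u j) ji) (fun i => gg (u i))
  (fun i j ij => w1 (u i) (u j) ij).
case am: (a ord_max) => /=; last first.
  have -> : \prod_(i < m) w ord_max (u i) ^+ 0 = 1 by apply: big1.
  by rewrite !expr0 !mulr1 mulrA IH -scalerAl.
rewrite ?expr1 -mulrA (mulrA (g ord_max)) cross -!scalerAl -scalerAr !mulrA IH.
rewrite -!scalerAl scalerA -!mulrA.
(* If the last generator occurs in both products, its square supplies the diagonal factor
   [w ord_max ord_max]. *)
case bm: (b ord_max) => /=.
  by rewrite ?expr1 ?expr0 mulr1 gg -scalerAr mulr1 scalerA; congr (_ *: _); ring.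
by rewrite ?expr0 ?expr1 !mulr1; congr (_ *: _); ring.
Qed.

(** * Families that multiply like the basis blades *)

Section TwistedBasis.
Variables (R : realType) (p q : nat).
Local Notation n := (p + q)%N.
Local Notation C := R[i].
Local Notation Cl := (Cl R p q).
Implicit Types (A B D S : {set 'I_n}) (U V W : Cl).

(** Swapping generator [b] past [D] costs [(-1) ^+ (#|D| + (b \in D))]. For even [#|D|] take [b] in
    [D]; for odd [#|D|] take it outside, which is possible because the full set of odd size is
    excluded. *)
Lemma anticommuting_generator D : D != finset.set0 ->
  ~~ (odd n && (D == finset.setT)) ->
  exists b : 'I_n, blade_sign R (finset.set1 b) D = - blade_sign R D (finset.set1 b).
Proof.
move=> D0 Dtop.
suff [b ob] : exists b : 'I_n, odd (#|D| + (b \in D)).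
  exists b; rewrite blade_signC cards1 mul1n.
  have -> : #|finset.set1 b :&: D| = (b \in D).
    have [bD|bD] := boolP (b \in D).
      by rewrite (finset.setIidPl _) ?cards1 // finset.sub1set.
    apply: eq_card0 => i; rewrite !inE; apply/negP => /andP[/eqP -> iD].
    by rewrite iD in bD.
  by rewrite -signr_odd ob mulN1r.
have [oD|eD] := boolP (odd #|D|); last first.
  by have /set0Pn[b bD] := D0; exists b; rewrite bD oddD (negPf eD).
have [b bD] : exists b, b \notin D.
  apply/existsP; rewrite -negb_forall; apply: contra Dtop => /forallP allD.
  have DT : D = finset.setT by apply/setP => i; rewrite allD inE.
  by move: oD; rewrite {1}DT cardsT card_ord => ->; rewrite DT eqxx.
by exists b; rewrite (negPf bD) addn0.
Qed.

(** An abstract family with the multiplication table of the blades; it serves both for the blades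
    themselves and for ordered products of other Clifford generators. *)
Variable H : {set 'I_n} -> Cl.
Hypothesis H0 : H finset.set0 = 1.
Hypothesis HM : forall A B, H A * H B = blade_sign R A B *: H (symdiff A B).

(** Carrying an anticommuting generator once around the cyclic trace shows that the trace equals its
    own negative. *)
Lemma clTr_anticommute U D : D != finset.set0 ->
  ~~ (odd n && (D == finset.setT)) ->
  (forall b, U * H (finset.set1 b) = H (finset.set1 b) * U) ->
  clTr (U * H D) = 0.
Proof.
move=> D0 Dtop UC; have [b sb] := anticommuting_generator D0 Dtop.
pose h := H (finset.set1 b).
have hD : h * H D = - (H D * h).
  by rewrite /h !HM sb symdiffC scaleNr.
have hh : h * h = (eta R b)%:A by rewrite /h HM symdiffxx H0 blade_sign1.
have E : eta R b * clTr (U * H D) = - (eta R b * clTr (U * H D)).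
  rewrite -clTrZ.
  have -> : eta R b *: (U * H D) = U * H D * h * h.
    by rewrite -mulrA hh mulr_algr.
  rewrite {1}clTrM !mulrA -UC -(mulrA U) hD mulrN mulNr.
  by rewrite -scaleN1r clTrZ mulN1r mulrA.
have : eta R b * (eta R b * clTr (U * H D)) = 0.
  suff -> : eta R b * clTr (U * H D) = 0 by rewrite mulr0.
  apply/eqP; have : (eta R b * clTr (U * H D)) *+ 2 == 0.
    by rewrite mulr2n {1}E addNr.
  by rewrite mulrn_eq0.
by rewrite mulrA eta_sqr mul1r.
Qed.

(** For odd [n] the full product commutes with all generators, so the anticommutation argument says
    nothing about it; this is where the trace condition enters. *)
Hypothesis Htop : odd n -> clTr (H finset.setT) = 0.

Lemma clTr_twisted D : D != finset.set0 -> clTr (H D) = 0.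
Proof.
move=> D0; have [/andP[on /eqP ->]|Dtop] := boolP (odd n && (D == finset.setT)).
  exact: Htop.
by rewrite -[H D]mul1r clTr_anticommute // => b; rewrite mul1r mulr1.
Qed.

(* Orthogonality of the [H B] for the trace form inverts the change of basis
   from the [clbasis R A] to the [H B]. *)
Lemma twisted_span U : exists c : {set 'I_n} -> C, U = \sum_B c B *: H B.
Proof.
pose N := #|{set 'I_n}|; pose e := @enum_val {set 'I_n} predT : 'I_N -> _.
pose M : 'M[C]_N := \matrix_(i, j) H (e i) (e j).
(* The square of [H (e k)] has trace [blade_sign R (e k) (e k)], which is its own inverse; hence
   this normalising factor. *)
pose T : 'M[C]_N := \matrix_(j, k)
  (clTr (clbasis R (e j) * H (e k)) * blade_sign R (e k) (e k)).
have MT : M *m T = 1%:M.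
  apply/matrixP => i k; rewrite !mxE.
  under eq_bigr do rewrite !mxE mulrA -clTrZ scalerAl.
  rewrite -mulr_suml.
  have -> : \sum_j clTr (H (e i) (e j) *: clbasis R (e j) * H (e k)) =
            clTr (H (e i) * H (e k)).
    rewrite [in RHS](clbasis_sum (H (e i))) mulr_suml clTr_sum.
    rewrite [RHS](reindex_onto e enum_rank) //= => [|? _]; last by rewrite /e enum_rankK.
    by rewrite [RHS](eq_bigl predT) => [|j]; rewrite ?enum_valK ?eqxx.
  rewrite HM clTrZ; have [->|ik] := eqVneq i k.
    by rewrite symdiffxx H0 clTr1 mulr1 blade_sign_sqr.
  rewrite clTr_twisted ?mulr0 ?mul0r // symdiff_eq0.
  by apply: contra ik => /eqP /enum_val_inj ->.
(* For square matrices the right inverse is also a left inverse, and [T *m M = 1] expands each basis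
   blade in the family [H]. *)
have TM := mulmx1C MT.
have span S : clbasis R S = \sum_B
    (clTr (clbasis R S * H B) * blade_sign R B B) *: H B.
  apply/ffunP => S'; have /matrixP /(_ (enum_rank S) (enum_rank S')) := TM.
  rewrite !mxE cl_sumE clbasisE (inj_eq enum_rank_inj) eq_sym => <-.
  rewrite [RHS](reindex_onto e enum_rank) //= => [|? _]; last by rewrite /e enum_rankK.
  rewrite [RHS](eq_bigl predT) => [|j]; last by rewrite enum_valK eqxx.
  by apply: eq_bigr => j _; rewrite !mxE /e !enum_rankK clZE.
exists (fun B => \sum_S U S * (clTr (clbasis R S * H B) * blade_sign R B B)).
rewrite [LHS]clbasis_sum; under eq_bigr do rewrite span scaler_sumr.
rewrite exchange_big; apply: eq_bigr => B _; rewrite scaler_suml.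
by apply: eq_bigr => S _; rewrite scalerA.
Qed.

End TwistedBasis.

(** * Elements commuting with a set of Clifford generators *)

Section CliffordGenerators.
Variables (R : realType) (p q : nat).
Local Notation n := (p + q)%N.
Local Notation C := R[i].
Local Notation Cl := (Cl R p q).
Implicit Types (A B D S : {set 'I_n}) (U V W : Cl).

(** Up to sign, the coefficient of [U] at [D] is the trace of [U] times the blade [D]. This vanishes
    for noncentral blades by anticommutation, and [in_clS] handles the others. *)
Lemma clS_central_eq0 U : (forall V, U * V = V * U) -> in_clS U -> U = 0.
Proof.
move=> UC [U0 Utop].
have e0 : clbasis R finset.set0 = 1 :> Cl by [].
have eM A B : clbasis R A * clbasis R B =
    blade_sign R A B *: clbasis R (symdiff A B) := clbasisM R A B.
apply/ffunP => D; rewrite [RHS]ffunE.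
have [->//|D0] := eqVneq D finset.set0.
have [/andP[on /eqP ->]|Dtop] := boolP (odd n && (D == finset.setT)).
  exact: Utop.
have := clTr_anticommute e0 eM D0 Dtop (fun b => UC _).
rewrite /clTr clmul_coef (bigD1 D) //= symdiffs0 big1 => [|A AD]; last first.
  by rewrite symdiffs0 clbasisE (negPf AD) mulr0 mul0r.
rewrite clbasisE eqxx mulr1 addr0 => /eqP.
by rewrite mulf_eq0 (negPf (blade_sign_neq0 _ _ _)) orbF => /eqP.
Qed.

Variable g : 'I_n -> Cl.
Hypothesis gA : forall i j, g i * g j + g j * g i =
  ((2 : C) * (if i == j then eta R i else 0)) *: 1.

Lemma gen_sqr i : g i * g i = (eta R i)%:A.
Proof.
have := gA i i; rewrite eqxx -mulr2n -scaler_nat -scalerA => E.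
have n2 : (2 : C) != 0 by rewrite pnatr_eq0.
by rewrite -[LHS](scalerK n2) [2 *: _]E scalerK.
Qed.

Lemma gen_anticomm i j : i != j -> g i * g j = - (g j * g i).
Proof.
move=> ij; apply/eqP; rewrite -addr_eq0 gA (negPf ij) mulr0 scale0r.
by [].
Qed.

(** Source of the constant 4: for distinct indices the inner commutator is [2 g i g j], with which
    [g i] again anticommutes, giving a second factor 2. *)
Lemma gen_double_comm i j :
  clcomm (eta R i *: g i) (clcomm (g i) (g j)) = (4 * (i != j)%:R) *: g j.
Proof.
rewrite !clcommE; have [->|ij] := eqVneq i j.
  rewrite [in RHS]mulr0 [RHS]scale0r (subrr (g j * g j)).
  by rewrite [X in X - _]mulr0 [X in _ - X]mul0r subr0.
rewrite (gen_anticomm (i := j)); last by rewrite eq_sym.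
rewrite opprK -mulr2n mulr1 -scalerAl -scalerAr -scalerBr.
rewrite mulrnAr mulrnAl.
have -> : g i * g j * g i = - (g i * (g i * g j)).
  by rewrite -mulrA (gen_anticomm (i := j)) ?mulrN // eq_sym.
rewrite mulNrn opprK -mulr2n -mulrnA mulrA gen_sqr mulr_algl scaler_nat.
by rewrite scalerMnr scalerA eta_sqr scale1r.
Qed.

(** Exponents 0 and 1 over all indices, instead of a product over [A], fit the boolean form of
    [ordered_prodM]. *)
Definition gen_blade A : Cl := \prod_i g i ^+ (i \in A).

Lemma gen_blade0 : gen_blade finset.set0 = 1.
Proof. by rewrite /gen_blade big1 // => i _; rewrite inE. Qed.

Lemma gen_bladeT : gen_blade finset.setT = clprod [seq g i | i <- enum 'I_n].
Proof.
rewrite clprodE big_map enumT /gen_blade [index_enum _]unlock.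
apply: eq_bigr => i _.
by rewrite finset.in_setT expr1.
Qed.

Lemma gen_bladeM A B :
  gen_blade A * gen_blade B = blade_sign R A B *: gen_blade (symdiff A B).
Proof.
rewrite /gen_blade (@ordered_prodM C Cl n g (@gen_sign R p q)
  (fun i => i \in A) (fun i => i \in B)).
- congr (_ *: _); last first.
    by apply: eq_bigr => i _; rewrite !inE; case: (i \in A); case: (i \in B).
  rewrite blade_signE [RHS]big_mkcond; apply: eq_bigr => i _.
  case: (i \in A); last by rewrite big1.
  by rewrite [RHS]big_mkcond; apply: eq_bigr => j _; case: (j \in B).
- move=> i j ji; rewrite /gen_sign ji scaleN1r gen_anticomm //.
  by rewrite -val_eqE /= gtn_eqF.
- by move=> i; rewrite /gen_sign ltnn eqxx gen_sqr.
- by move=> i j ij; rewrite /gen_sign -val_eqE /= ltnNge (ltnW ij) ltn_eqF.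
Qed.

Hypothesis gtop : clTr (clprod [seq g i | i <- enum 'I_n]) = 0.

(** Commuting with the generators gives commuting with their ordered products, which span the
    algebra by [twisted_span]; so [U] is central. *)
Lemma gen_commutant_clS U :
  (forall i, U * g i = g i * U) -> in_clS U -> U = 0.
Proof.
move=> Ug; apply: clS_central_eq0 => V.
have UH A : U * gen_blade A = gen_blade A * U.
  rewrite /gen_blade; apply: (big_ind (fun W => U * W = W * U)).
  - by rewrite mulr1 mul1r.
  - by move=> X Y UX UY; rewrite mulrA UX -mulrA UY mulrA.
  - by move=> i _; case: (i \in A); rewrite ?expr1 ?expr0 ?mulr1 ?mul1r.
have gT : odd n -> clTr (gen_blade finset.setT) = 0 by rewrite gen_bladeT.
have [c ->] := twisted_span gen_blade0 gen_bladeM gT V.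
rewrite mulr_sumr mulr_suml; apply: eq_bigr => B _.
by rewrite -scalerAr UH scalerAl.
Qed.

End CliffordGenerators.

(** * Symmetry of second directional derivatives *)

Section MixedPartials.
Variables (R : realType) (V : normedModType R).
Implicit Types (g : V -> R) (x u v : V).

Lemma is_derive_line g x v (t : R) : derivable g (x + t *: v) v ->
  is_derive t 1 (fun s => g (x + s *: v)) ('D_v g (x + t *: v)).
Proof.
have E : (fun h : R => h^-1 *: (((fun s => g (x + s *: v)) \o shift t) (h *: 1)
            - g (x + t *: v))) =
         (fun h => h^-1 *: ((g \o shift (x + t *: v)) (h *: v) - g (x + t *: v))).
  apply/funext => h /=; congr (_ *: (g _ - _)).
  by rewrite [h *: 1]mulr1 scalerDl addrCA.
by move=> dg; apply: DeriveDef; rewrite /derivable /derive E.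
Qed.

Lemma line_MVT g x v (t : R) : 0 < t -> (forall y, derivable g y v) ->
  exists2 c : R, 0 < c < t & g (x + t *: v) - g x = t * 'D_v g (x + c *: v).
Proof.
move=> t0 dg; have ds s := is_derive_line (dg (x + s *: v)).
have cg : {within `[0, t], continuous (fun s => g (x + s *: v))}.
  apply: derivable_within_continuous => s _.
  exact: (@ex_derive _ _ _ _ _ _ _ (ds s)).
have [c] := @MVT R (fun s => g (x + s *: v)) _ 0 t t0 (fun s _ => ds s) cg.
rewrite in_itv /= => ct E; exists c => //; move: E.
by rewrite scale0r addr0 subr0 mulrC.
Qed.

(** Two uses of the mean value theorem: along [u] for the increment [g (y + s *: v) - g y], then
    along [v] for ['D_u g]. *)
Lemma mixed_difference g x u v (s : R) : 0 < s ->
  (forall y, derivable g y u) -> (forall y, derivable ('D_u g) y v) ->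
  exists c d : R, [/\ 0 < c < s, 0 < d < s &
    g (x + s *: u + s *: v) - g (x + s *: u) - (g (x + s *: v) - g x) =
    s * (s * 'D_v ('D_u g) (x + c *: u + d *: v))].
Proof.
move=> s0 dg ddg.
pose a y := g (y + s *: v) - g y.
have dsh y : is_derive y u (fun z => g (z + s *: v)) ('D_u g (y + s *: v)).
  have E : (fun h : R => h^-1 *: (((fun z => g (z + s *: v)) \o shift y) (h *: u)
              - g (y + s *: v))) =
           (fun h => h^-1 *: ((g \o shift (y + s *: v)) (h *: u) - g (y + s *: v))).
    by apply/funext => h /=; rewrite addrA.
  by apply: DeriveDef; rewrite /derivable /derive E //; exact: dg.
have da y : is_derive y u a ('D_u g (y + s *: v) - 'D_u g y).
  exact: (is_deriveB (dsh y) (derivableP (dg y))).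
have [c cs Ec] := @line_MVT a x u s s0 (fun y => @ex_derive _ _ _ _ _ _ _ (da y)).
have [d dss Ed] := @line_MVT ('D_u g) (x + c *: u) v s s0 ddg.
exists c, d; split => //; rewrite -Ed -(@derive_val _ _ _ _ _ _ _ (da _)).
exact: Ec.
Qed.

Lemma cvg_affine2 x u v (c d : R -> R) :
  (forall s, 0 < s -> 0 < c s < s) -> (forall s, 0 < s -> 0 < d s < s) ->
  x + c s *: u + d s *: v @[s --> 0^'+] --> x.
Proof.
have cvg0 (a : R -> R) : (forall s, 0 < s -> 0 < a s < s) -> a s @[s --> 0^'+] --> 0.
  move=> as0; apply: (@squeeze_cvgr _ _ _ _ (cst 0) id).
  - near=> s; have s0 : 0 < s by near: s; exact: nbhs_right_gt.
    by have /andP[/ltW -> /ltW ->] := as0 s s0.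
  - exact: cvg_cst.
  - exact: cvg_at_right_filter cvg_id.
move=> /cvg0 c0 /cvg0 d0.
rewrite [X in _ --> X](_ : x = x + 0 *: u + 0 *: v); last first.
  by rewrite !scale0r !addr0.
exact: cvgD (cvgD (cvg_cst x) (cvgZr_tmp c0)) (cvgZr_tmp d0).
Unshelve. all: by end_near. Qed.

(** The second difference is symmetric in [u] and [v], so the two mixed derivatives agree at points
    tending to [x] with [s]; continuity then identifies their values at [x]. *)
Lemma deriveC g u v x :
  (forall y, derivable g y u) -> (forall y, derivable g y v) ->
  (forall y, derivable ('D_u g) y v) -> (forall y, derivable ('D_v g) y u) ->
  continuous ('D_v ('D_u g)) -> continuous ('D_u ('D_v g)) ->
  'D_v ('D_u g) x = 'D_u ('D_v g) x.
Proof.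
move=> gu gv guv gvu cuv cvu.
(* Keeping [0 < s] under the existential lets [choice] produce total functions of [s]; the zeros
   chosen for other [s] are arbitrary. *)
have ex s : exists w : (R * R) * (R * R), 0 < s ->
   [/\ 0 < w.1.1 < s, 0 < w.1.2 < s, 0 < w.2.1 < s, 0 < w.2.2 < s &
   'D_v ('D_u g) (x + w.1.1 *: u + w.1.2 *: v) =
   'D_u ('D_v g) (x + w.2.1 *: v + w.2.2 *: u)].
  have [s0|] := ltP 0 s; last by exists ((0, 0), (0, 0)).
  have [c [d [cs ds E]]] := mixed_difference x s0 gu guv.
  have [c' [d' [cs' ds' E']]] := mixed_difference x s0 gv gvu.
  have sn0 : s != 0 by rewrite gt_eqF.
  have subCA (a b a' b' : R) : a - b - (a' - b') = a - a' - (b - b') by ring.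
  exists ((c, d), (c', d')) => _; split; [exact: cs|exact: ds|exact: cs'|exact: ds'|].
  apply: (mulfI sn0); apply: (mulfI sn0); apply: (etrans (esym E)); apply: etrans E'.
  by rewrite (addrAC x (s *: v)) subCA.
have [w wP] := choice ex.
have cw1 : x + (w s).1.1 *: u + (w s).1.2 *: v @[s --> 0^'+] --> x.
  by apply: cvg_affine2 => s /wP[].
have cw2 : x + (w s).2.1 *: v + (w s).2.2 *: u @[s --> 0^'+] --> x.
  by apply: cvg_affine2 => s /wP[].
pose a s := 'D_v ('D_u g) (x + (w s).1.1 *: u + (w s).1.2 *: v).
pose b s := 'D_u ('D_v g) (x + (w s).2.1 *: v + (w s).2.2 *: u).
have ab : {near 0^'+, b =1 a}.
  near=> s; have s0 : 0 < s by near: s; exact: nbhs_right_gt.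
  by have [_ _ _ _ /esym] := wP s s0.
have L1 : a s @[s --> 0^'+] --> 'D_v ('D_u g) x := cvg_comp _ _ cw1 (cuv x).
have L2 : b s @[s --> 0^'+] --> 'D_u ('D_v g) x := cvg_comp _ _ cw2 (cvu x).
have L3 : a s @[s --> 0^'+] --> 'D_u ('D_v g) x.
  exact: cvg_trans (near_eq_cvg ab) L2.
exact: (cvg_unique (@norm_hausdorff _ _) L1 L3).
Unshelve. all: by end_near. Qed.

End MixedPartials.

(** * Coefficientwise calculus for Clifford-valued functions *)

Section CliffordDerivative.
Variables (R : realType) (p q : nat).
Local Notation n := (p + q)%N.
Local Notation C := R[i].
Local Notation Cl := (Cl R p q).
Local Notation E := 'rV[R]_n.
Implicit Types (f g : E -> C) (F G : E -> Cl) (x v : E).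

Definition is_cderive x v f (d : C) : Prop :=
  is_derive x v (fun y => complex.Re (f y)) (complex.Re d) /\
  is_derive x v (fun y => complex.Im (f y)) (complex.Im d).

Lemma is_cderive_cst x v (a : C) : is_cderive x v (fun=> a) 0.
Proof. by split; exact: is_derive_cst. Qed.

Lemma is_cderiveD x v f g (df dg : C) : is_cderive x v f df ->
  is_cderive x v g dg -> is_cderive x v (fun y => f y + g y) (df + dg).
Proof.
move=> [fr fi] [gr gi]; split.
- have -> : (fun y => complex.Re (f y + g y)) =
      (fun y => complex.Re (f y)) + (fun y => complex.Re (g y)).
    by apply/funext => y; rewrite raddfD.
  by rewrite raddfD; exact: is_deriveD.
- have -> : (fun y => complex.Im (f y + g y)) =
      (fun y => complex.Im (f y)) + (fun y => complex.Im (g y)).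
    by apply/funext => y; rewrite raddfD.
  by rewrite raddfD; exact: is_deriveD.
Qed.

Lemma is_cderiveM x v f g (df dg : C) : is_cderive x v f df ->
  is_cderive x v g dg ->
  is_cderive x v (fun y => f y * g y) (df * g x + f x * dg).
Proof.
have ReM (a b : C) : complex.Re (a * b) =
    complex.Re a * complex.Re b - complex.Im a * complex.Im b.
  by case: a => ? ?; case: b.
have ImM (a b : C) : complex.Im (a * b) =
    complex.Re a * complex.Im b + complex.Im a * complex.Re b.
  by case: a => ? ?; case: b.
move=> [fr fi] [gr gi]; split.
- have -> : (fun y => complex.Re (f y * g y)) =
      (fun y => complex.Re (f y)) * (fun y => complex.Re (g y)) -
      (fun y => complex.Im (f y)) * (fun y => complex.Im (g y)).
    by apply/funext => y; rewrite ReM.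
  have D := is_deriveB (is_deriveM fr gr) (is_deriveM fi gi).
  rewrite raddfD /= !ReM; apply: is_derive_eq D _; rewrite /GRing.scale /=; ring.
- have -> : (fun y => complex.Im (f y * g y)) =
      (fun y => complex.Re (f y)) * (fun y => complex.Im (g y)) +
      (fun y => complex.Im (f y)) * (fun y => complex.Re (g y)).
    by apply/funext => y; rewrite ImM.
  have D := is_deriveD (is_deriveM fr gi) (is_deriveM fi gr).
  rewrite raddfD /= !ImM; apply: is_derive_eq D _; rewrite /GRing.scale /=; ring.
Qed.

Lemma is_cderive_sum (I : Type) (r : seq I) x v (f : I -> E -> C) (d : I -> C) :
  (forall i, is_cderive x v (f i) (d i)) ->
  is_cderive x v (fun y => \sum_(i <- r) f i y) (\sum_(i <- r) d i).
Proof.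
move=> fd; elim: r => [|i r IH].
  under eq_fun do rewrite big_nil.
  by rewrite big_nil; exact: is_cderive_cst.
under eq_fun do rewrite big_cons.
by rewrite big_cons; exact: is_cderiveD.
Qed.

(** The relational form also records that the partial derivatives exist, which an equation on
    [clpartial] would not. *)
Definition is_clpartial (mu : 'I_n) F x (D : Cl) : Prop :=
  forall A, is_cderive x (unitv R mu) (fun y => F y A) (D A).

Lemma clpartial_val mu F x D : is_clpartial mu F x D -> clpartial mu F x = D.
Proof.
move=> FD; apply/ffunP => A; rewrite ffunE /pdR.
have [r i] := FD A; rewrite (@derive_val _ _ _ _ _ _ _ r).
by rewrite (@derive_val _ _ _ _ _ _ _ i); case: (D A).
Qed.

Lemma C2Cl_is_clpartial mu F x : C2Cl F -> is_clpartial mu F x (clpartial mu F x).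
Proof.
move=> F2 A; rewrite ffunE; have [[_ [dr _]] [_ [di _]]] := F2 A.
by split; exact: derivableP.
Qed.

Lemma is_clpartialD mu F G x D D' : is_clpartial mu F x D ->
  is_clpartial mu G x D' -> is_clpartial mu (fun y => F y + G y) x (D + D').
Proof.
move=> FD GD A; under eq_fun do rewrite clDE.
by rewrite clDE; exact: is_cderiveD.
Qed.

Lemma is_clpartialZ mu (a : C) F x D : is_clpartial mu F x D ->
  is_clpartial mu (fun y => a *: F y) x (a *: D).
Proof.
move=> FD A; under eq_fun do rewrite clZE.
rewrite clZE -[a * _]add0r -[X in X + _](mul0r (F x A)).
by apply: is_cderiveM => //; exact: is_cderive_cst.
Qed.

Lemma is_clpartialB mu F G x D D' : is_clpartial mu F x D ->
  is_clpartial mu G x D' -> is_clpartial mu (fun y => F y - G y) x (D - D').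
Proof.
move=> FD GD; rewrite -scaleN1r.
have -> : (fun y => F y - G y) = (fun y => F y + (-1) *: G y).
  by apply/funext => y; rewrite scaleN1r.
by apply: is_clpartialD => //; exact: is_clpartialZ.
Qed.

(** By [clmul_coef] each coefficient of the product is a finite sum of products of two coefficients
    with a constant sign. *)
Lemma is_clpartialM mu F G x D D' : is_clpartial mu F x D ->
  is_clpartial mu G x D' ->
  is_clpartial mu (fun y => F y * G y) x (D * G x + F x * D').
Proof.
move=> FD GD S; under eq_fun do rewrite clmul_coef.
rewrite clDE !clmul_coef -big_split; apply: is_cderive_sum => A /=.
rewrite -mulrDl -[X in is_cderive _ _ _ X]addr0.
rewrite -[X in _ + X](mulr0 (F x A * G x (symdiff A S))).
by apply: is_cderiveM; [exact: is_cderiveM|exact: is_cderive_cst].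
Qed.

Lemma is_clpartial_comm mu F G x D D' : is_clpartial mu F x D ->
  is_clpartial mu G x D' -> is_clpartial mu (fun y => clcomm (F y) (G y)) x
    (clcomm D (G x) + clcomm (F x) D').
Proof.
move=> FD GD; rewrite !clcommE.
have -> : D * G x - G x * D + (F x * D' - D' * F x) =
  (D * G x + F x * D') - (D' * F x + G x * D).
  by rewrite addrACA -opprD (addrC (G x * D)).
by apply: is_clpartialB; exact: is_clpartialM.
Qed.

Lemma clpartialC mu nu F x : C2Cl F ->
  clpartial mu (clpartial nu F) x = clpartial nu (clpartial mu F) x.
Proof.
have pdC (g : E -> R) : C2R g -> pdR mu (pdR nu g) x = pdR nu (pdR mu g) x.
  move=> [_ [d1 [_ [d2 c2]]]].
  exact: (deriveC x (d1 nu) (d1 mu) (d2 nu mu) (d2 mu nu) (c2 nu mu) (c2 mu nu)).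
move=> F2; apply/ffunP => A; have [r i] := F2 A.
have rE ka : (fun y => complex.Re (clpartial ka F y A)) =
    pdR ka (fun y => complex.Re (F y A)).
  by apply/funext => y; rewrite ffunE.
have iE ka : (fun y => complex.Im (clpartial ka F y A)) =
    pdR ka (fun y => complex.Im (F y A)).
  by apply/funext => y; rewrite ffunE.
rewrite [LHS]ffunE [RHS]ffunE !rE !iE (pdC _ r).
by rewrite (pdC _ i).
Qed.

End CliffordDerivative.

(** * Commutators and elements without central part *)

Lemma ring_jacobi (A : pzRingType) (u v w : A) :
  u * (v * w - w * v) - (v * w - w * v) * u =
  (u * v - v * u) * w - w * (u * v - v * u) +
  (v * (u * w - w * u) - (u * w - w * u) * v).
Proof.
rewrite !(mulrBl, mulrBr) !opprB !mulrA.
by rewrite [RHS]addrACA !subrKA addrACA [X in _ + X]addrC -addrACA.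
Qed.

Section Commutator.
Variables (R : realType) (p q : nat).
Implicit Types (U V W : Cl R p q) (a : R[i]).

Lemma clcommDl U V W : clcomm (U + V) W = clcomm U W + clcomm V W.
Proof. by rewrite !clcommE mulrDl mulrDr opprD addrACA. Qed.

Lemma clcommDr U V W : clcomm W (U + V) = clcomm W U + clcomm W V.
Proof. by rewrite !clcommE mulrDl mulrDr opprD addrACA. Qed.

Lemma clcommZl a U V : clcomm (a *: U) V = a *: clcomm U V.
Proof. by rewrite !clcommE -scalerAl -scalerAr -scalerBr. Qed.

Lemma clcommZr a U V : clcomm V (a *: U) = a *: clcomm V U.
Proof. by rewrite !clcommE -scalerAl -scalerAr -scalerBr. Qed.

Lemma clcommNl U V : clcomm (- U) V = - clcomm U V.
Proof. by rewrite -scaleN1r clcommZl scaleN1r. Qed.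

Lemma clcommBl U V W : clcomm (U - V) W = clcomm U W - clcomm V W.
Proof. by rewrite clcommDl clcommNl. Qed.

Lemma clcommC U V : clcomm U V = - clcomm V U.
Proof. by rewrite !clcommE opprB. Qed.

(** The derivation form of the Jacobi identity, matching the Leibniz rule [is_clpartial_comm]. *)
Lemma clcomm_jacobi U V W :
  clcomm U (clcomm V W) = clcomm (clcomm U V) W + clcomm V (clcomm U W).
Proof.
exact: ring_jacobi.
Qed.

(** Both central coefficients of a product are unchanged when its factors are swapped. *)
Lemma in_clS_comm U V : in_clS (clcomm U V).
Proof.
split=> [|on]; rewrite clcommE clDE clNE.
  by have := clTrM U V; rewrite /clTr => ->; rewrite subrr.
by rewrite clmul_topC // subrr.
Qed.

Lemma in_clSD U V : in_clS U -> in_clS V -> in_clS (U + V).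
Proof.
move=> [U0 UT] [V0 VT]; split=> [|on]; rewrite clDE ?U0 ?V0 ?addr0 //.
by rewrite UT // VT // addr0.
Qed.

Lemma in_clSZ a U : in_clS U -> in_clS (a *: U).
Proof.
by move=> [U0 UT]; split=> [|on]; rewrite clZE ?U0 ?mulr0 // UT // mulr0.
Qed.

Lemma in_clSB U V : in_clS U -> in_clS V -> in_clS (U - V).
Proof. by move=> HU HV; rewrite -scaleN1r; apply/in_clSD/in_clSZ. Qed.

Lemma in_clS_partial mu (F : 'rV[R]_(p + q) -> Cl R p q) x :
  (forall y, in_clS (F y)) -> in_clS (clpartial mu F x).
Proof.
have pd0 A : (forall y, F y A = 0) -> clpartial mu F x A = 0.
  move=> F0; rewrite ffunE /pdR; under eq_fun do rewrite F0.
  under [X in Complex _ (derive X _ _)]eq_fun do rewrite F0.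
  by rewrite !derive_cst.
by move=> FS; split=> [|on]; apply: pd0 => y; have [F0 FT] := FS y; auto.
Qed.

End Commutator.

(** * Flatness of [Cf] and the Yang-Mills equations *)

Section YangMills.
Variables (R : realType) (p q : nat).
Local Notation n := (p + q)%N.
Variables h Cf : 'I_n -> 'rV[R]_n -> Cl R p q.
Hypothesis h_clifford : clifford_field_vector h.
Hypothesis Cf_clS : forall mu x, in_clS (Cf mu x).
Hypothesis h_C2 : forall mu, C2Cl (h mu).
Hypothesis Cf_C2 : forall mu, C2Cl (Cf mu).
Hypothesis h_parallel : forall mu rho x,
  clpartial mu (lower h rho) x - clcomm (Cf mu x) (lower h rho x) = 0.

Lemma is_clpartial_h mu rho x :
  is_clpartial mu (h rho) x (clcomm (Cf mu x) (h rho x)).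
Proof.
have hd := C2Cl_is_clpartial mu x (h_C2 rho).
suff <- : clpartial mu (h rho) x = clcomm (Cf mu x) (h rho x) by [].
have /eqP := h_parallel mu rho x.
rewrite (clpartial_val (is_clpartialZ (eta R rho) hd)) /lower clcommZr.
rewrite subr_eq0 => /eqP; apply: can_inj (scalerK _) _ _.
by apply/eqP => eta0; have /eqP := eta_sqr R rho; rewrite eta0 mul0r eq_sym oner_eq0.
Qed.

(* Equality of the mixed partials of [h rho] makes the curvature of [Cf] commute
   with every [h rho], hence central. *)
Lemma Cf_flat mu nu x :
  clpartial mu (Cf nu) x - clpartial nu (Cf mu) x - clcomm (Cf mu x) (Cf nu x) = 0.
Proof.
have [gA gtop] := h_clifford x.
apply: (gen_commutant_clS gA gtop); last first.
  apply: in_clSB; last exact: in_clS_comm.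
  by apply: in_clSB; exact: in_clS_partial.
move=> rho; apply/eqP; rewrite -subr_eq0 -clcommE.
have pdh ka : clpartial ka (h rho) = fun y => clcomm (Cf ka y) (h rho y).
  by apply/funext => y; exact: clpartial_val (is_clpartial_h ka rho y).
have ddh ka la : clpartial ka (clpartial la (h rho)) x =
    clcomm (clpartial ka (Cf la) x) (h rho x) +
    clcomm (Cf la x) (clcomm (Cf ka x) (h rho x)).
  rewrite pdh; apply: clpartial_val; apply: is_clpartial_comm.
    exact: C2Cl_is_clpartial.
  exact: is_clpartial_h.
(* After the Jacobi identity both sides end in the same double commutator, which cancels and leaves
   the curvature commuted with [h rho x]. *)
have := clpartialC mu nu x (h_C2 rho); rewrite !ddh (clcomm_jacobi (Cf mu x)).
rewrite [X in _ = X -> _]addrA => /addIr E.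
have subDD (b j : Cl R p q) : b + j - b - j = 0 by rewrite -addrA -opprD subrr.
by rewrite 2!clcommBl E subDD.
Qed.

Variable sigma : R[i].
Local Notation B := (YM_B sigma h Cf).

Lemma YM_B_clS mu x : in_clS (h mu x) -> in_clS (B mu x).
Proof. by move=> hS; apply: in_clSD => //; do 2 apply: in_clSZ. Qed.

(** The derivatives of the [h] part of [B] cancel the mixed commutators of [h] with [Cf], and the
    terms in [Cf] alone form its vanishing curvature. *)
Lemma YM_Gup_eq mu nu :
  YM_Gup B mu nu = fun x => - sigma ^+ 2 *: clcomm (h mu x) (h nu x).
Proof.
apply/funext => x; rewrite /YM_Gup /YM_G.
have dB ka la : clpartial ka (B la) x =
    sigma *: clcomm (Cf ka x) (lower h la x) + clpartial ka (Cf la) x.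
  apply: clpartial_val; apply: is_clpartialD; last exact: C2Cl_is_clpartial.
  apply: is_clpartialZ; rewrite /lower clcommZr; apply: is_clpartialZ.
  exact: is_clpartial_h.
have -> : clcomm (h mu x) (h nu x) =
    (eta R mu * eta R nu) *: clcomm (lower h mu x) (lower h nu x).
  rewrite /lower clcommZl clcommZr !scalerA.
  by rewrite -mulrA mulrACA !eta_sqr mulr1 scale1r.
rewrite [RHS]scalerA [in RHS]mulrC -[RHS]scalerA; congr (_ *: _).
(* Flatness trades the commutator of [Cf mu x] and [Cf nu x] for the derivatives of [Cf], so that
   everything else cancels linearly. *)
have -> : clcomm (B mu x) (B nu x) =
    sigma ^+ 2 *: clcomm (lower h mu x) (lower h nu x)
    - sigma *: clcomm (Cf nu x) (lower h mu x)
    + (sigma *: clcomm (Cf mu x) (lower h nu x)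
    + (clpartial mu (Cf nu) x - clpartial nu (Cf mu) x)).
  have /eqP := Cf_flat mu nu x; rewrite subr_eq0 => /eqP ->.
  rewrite /YM_B; move: (lower h mu x) (lower h nu x) => hm hn.
  rewrite clcommDl !clcommDr !clcommZl !clcommZr.
  by rewrite (clcommC hm (Cf nu x)) scalerN scalerA -expr2.
have cancel6 (a b c d e : Cl R p q) :
    a + d - (b + e) - (c - b + (a + (d - e))) = - c.
  have -> : c - b + (a + (d - e)) = c + (a + d - (b + e)).
    rewrite -[LHS]addrA; congr (c + _).
    by rewrite opprD [RHS]addrACA [LHS]addrCA [LHS]addrA.
  by move: (a + d - _) => y; rewrite opprD addrCA subrr addr0.
by rewrite !dB cancel6 scaleNr.
Qed.

(** The Leibniz rule and the Jacobi identity make the commutator of [h mu] and [h nu] covariantly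
    constant for [Cf], so only the part [sigma *: lower h mu x] of [B mu x] acts, through
    [gen_double_comm]. *)
Lemma YM_divergence_term mu nu x :
  clpartial mu (YM_Gup B mu nu) x - clcomm (B mu x) (YM_Gup B mu nu x) =
  (4 * sigma ^+ 3 * (mu != nu)%:R) *: h nu x.
Proof.
rewrite YM_Gup_eq.
have -> : clpartial mu (fun y => - sigma ^+ 2 *: clcomm (h mu y) (h nu y)) x =
    - sigma ^+ 2 *: clcomm (Cf mu x) (clcomm (h mu x) (h nu x)).
  rewrite clcomm_jacobi; apply: clpartial_val; apply: is_clpartialZ.
  by apply: is_clpartial_comm; exact: is_clpartial_h.
rewrite clcommZr -scalerBr /YM_B clcommDl opprD addrCA subrr addr0 clcommZl.
have [gA _] := h_clifford x.
rewrite /lower (gen_double_comm gA) scalerN scaleNr opprK !scalerA.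
by congr (_ *: _); ring.
Qed.

End YangMills.

Theorem theorem9 (R : realType) (p q : nat)
  (h Cf : 'I_(p + q) -> 'rV[R]_(p + q) -> Cl R p q)
  (sigma eps : R[i]) :
  clifford_field_vector h ->
  (forall mu x, in_clS (h mu x)) ->
  (forall mu x, in_clS (Cf mu x)) ->
  (forall mu, C2Cl (h mu)) ->
  (forall mu, C2Cl (Cf mu)) ->
  (forall mu rho x,
     clpartial mu (lower h rho) x - clcomm (Cf mu x) (lower h rho x) = 0) ->
  eps = 4 * ((p + q)%:R - 1) * sigma ^+ 3 ->
  let B := YM_B sigma h Cf in
  let G := YM_G B in
  (forall mu x, in_clS (B mu x)) /\
  (forall mu nu x,
     clpartial mu (B nu) x - clpartial nu (B mu) x - clcomm (B mu x) (B nu x)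
       = G mu nu x) /\
  (forall nu x,
     \sum_(mu < p + q)
        (clpartial mu (YM_Gup B mu nu) x - clcomm (B mu x) (YM_Gup B mu nu x))
       = eps *: h nu x).
Proof.
move=> hcl hS CS h2 C2 hpar epsE B G; split; [|split].
- by move=> mu x; exact: YM_B_clS.
- by [].
move=> nu x.
under eq_bigr do rewrite YM_divergence_term //.
rewrite -scaler_suml -mulr_sumr epsE; congr (_ *: _).
(* The factor [n - 1] in [eps] counts the indices different from [nu]. *)
have -> : \sum_(mu < p + q) (mu != nu)%:R = (p + q)%:R - 1 :> R[i].
  rewrite (bigD1 nu) //= eqxx add0r (eq_bigr (fun=> 1)); last by move=> mu ->.
  apply/eqP; rewrite eq_sym subr_eq.
  have := sumr_const (ordinal (p + q)) (1 : R[i]); rewrite card_ord => <-.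
  by rewrite [X in X == _](bigD1 nu) //= addrC.
ring.
Qed.
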